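(* Let $\mathbf{k}$ be a perfect field with algebraic closure $\overline{\mathbf{k}}$, and let $d\ge 2$. Then for every homogeneous polynomial $f$ of degree $d$ over $\mathbf{k}$ one has $$\operatorname{srk}_{\mathbf{k}}(f)\le d\cdot \operatorname{srk}_{\overline{\mathbf{k}}}(f),$$ and for every finite collection $f_1,\ldots,f_s$ of homogeneous polynomials of degree $d$ over $\mathbf{k}$ (in the same variables) one has $$\operatorname{srk}_{\mathbf{k}}(f_1,\ldots,f_s)\le d\cdot s\cdot \operatorname{srk}_{\overline{\mathbf{k}}}(f_1,\ldots,f_s).$$
   Context: For a field $K$ and a homogeneous polynomial $f\in K[x_1,\ldots,x_n]$, the slice rank $\operatorname{srk}_K(f)$ is the minimal number $r\ge 0$ such that there is a decomposition $f=l_1f_1+\ldots+l_rf_r$, where the $l_i$ are linear forms with coefficients in $K$ and the $f_i$ are homogeneous polynomials of degree $\deg f-1$ with coefficients in $K$ (so the slice rank of $0$ is $0$). A polynomial over $\mathbf{k}$ is also viewed as a polynomial over $\overline{\mathbf{k}}$. For homogeneous polynomials $f_1,\ldots,f_s$ of the same degree over $K$, $$\operatorname{srk}_K(f_1,\ldots,f_s)=\inf_{(c_1,\ldots,c_s)\in K^s\setminus\{0\}}\operatorname{srk}_K(c_1f_1+\ldots+c_sf_s).$$ *)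

(* Defs.v *)
From HB Require Import structures.
From mathcomp Require Import all_boot all_order all_algebra all_field.
From mathcomp Require Import boolp.
From mathcomp Require Export mpoly.

Set Implicit Arguments.
Unset Strict Implicit.
Unset Printing Implicit Defensive.

Import GRing.Theory.
Local Open Scope ring_scope.

Definition perfect_field (K : fieldType) : Prop :=
  forall p : {poly K}, irreducible_poly p -> separable_poly p.

(* The infimum of a set of natural numbers, with the junk value 0 for the empty
   set; [slice_decomposition_ex] and [collective_slice_rank_spec] show that no
   empty set occurs for forms of positive degree and nonempty collections. *)
Definition natinf (P : nat -> Prop) : nat :=
  if pselect (exists r, (fun r => `[< P r >]) r) is left exP
  then ex_minn exP else 0.

Lemma natinf_spec (P : nat -> Prop) : (exists r, P r) ->
  P (natinf P) /\ (forall r, P r -> (natinf P <= r)%N).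
Proof.
move=> [r0 Pr0]; rewrite /natinf; case: pselect => [exP|[]]; last first.
  by exists r0; apply/asboolP.
case: ex_minnP => m /asboolP Pm min_m; split=> // r Pr.
by apply: min_m; apply/asboolP.
Qed.

(* The degree of a nonzero f is (msize f).-1, so the cofactors g i have degree
   deg f - 1. *)
Definition slice_decomposition (K : fieldType) (n : nat)
    (f : {mpoly K[n]}) (r : nat) : Prop :=
  exists l g : 'I_r -> {mpoly K[n]},
    [/\ forall i, l i \is 1.-homog,
        forall i, g i \is (msize f).-2.-homog
      & f = \sum_(i < r) l i * g i].

Definition slice_rank (K : fieldType) (n : nat) (f : {mpoly K[n]}) : nat :=
  natinf (slice_decomposition f).

Definition collective_slice_rank (K : fieldType) (n s : nat)
    (f : 'I_s -> {mpoly K[n]}) : nat :=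
  natinf (fun r => exists c : {ffun 'I_s -> K},
    c != 0 /\ r = slice_rank (\sum_(i < s) c i *: f i)).

Lemma slice_decomposition_ex (K : fieldType) (n d : nat) (f : {mpoly K[n]}) :
  (0 < d)%N -> f \is d.-homog -> exists r, slice_decomposition f r.
Proof.
move=> d_gt0 fd; have [->|f_neq0] := eqVneq f 0.
  by exists 0%N, (fun=> 0), (fun=> 0); split; [case|case|rewrite big_ord0].
have sz_f : (msize f).-2 = d.-1.
  by rewrite -(dhomog_uniq f_neq0 fd (dhomog_msize fd)).
have /dhomogP hf := fd.
pose v (m : 'X_{1..n}) : option 'I_n := [pick i | 0 < m i]%N.
exists n, (fun i => 'X_i), (fun i =>
  \sum_(m <- msupp f | v m == Some i) f@_m *: 'X_[m - U_(i)]); split.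
- by move=> i; rewrite dhomogX /= mdeg1.
- move=> i; rewrite sz_f big_seq_cond; apply: rpred_sum => m /andP[m_f].
  rewrite /v; case: pickP => // j mj /eqP[<-]; apply: rpredZ.
  have mdj : mdeg m = d by apply: hf.
  have le1m : (U_(j) <= m)%MM by rewrite lep1mP -lt0n.
  rewrite dhomogX /=; apply/eqP.
  by rewrite -mdj -{2}(submK le1m) mdegD mdeg1 addn1.
rewrite {1}[f]mpolyE.
under [RHS]eq_bigr => i _ do rewrite mulr_sumr big_mkcond /=.
rewrite exchange_big /= !big_seq; apply: eq_bigr => m m_f.
have mdm : mdeg m = d by apply: hf.
rewrite -big_mkcond /= /v; case: pickP => [j mj|m0].
  rewrite (big_pred1 j) => [|i]; last by rewrite /= eq_sym.
  rewrite -scalerAr -mpolyXD addmBA ?lep1mP -?lt0n //.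
  by rewrite addmC addmK.
move: d_gt0; rewrite -mdm mdegE big1 // => i _.
by apply/eqP; rewrite -leqn0 leqNgt m0.
Qed.

Lemma collective_slice_rank_spec (K : fieldType) (n s : nat)
    (f : 'I_s -> {mpoly K[n]}) : (0 < s)%N ->
  (exists2 c : {ffun 'I_s -> K}, c != 0 &
     collective_slice_rank f = slice_rank (\sum_(i < s) c i *: f i)) /\
  (forall c : {ffun 'I_s -> K}, c != 0 ->
     (collective_slice_rank f <= slice_rank (\sum_(i < s) c i *: f i))%N).
Proof.
move=> s_gt0; pose c1 : {ffun 'I_s -> K} := [ffun=> 1].
have c1_neq0 : c1 != 0.
  apply/eqP => /ffunP /(_ (Ordinal s_gt0)) /eqP.
  by rewrite !ffunE oner_eq0.
have [|[c [c_neq0 eq_c]] min_c] := natinf_spec (P := fun r =>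
  exists c : {ffun 'I_s -> K},
    c != 0 /\ r = slice_rank (\sum_(i < s) c i *: f i)).
  by eexists; exists c1.
by split=> [|c' c'_neq0]; [exists c | apply: min_c; exists c'].
Qed.

(* Main.v *)
Require Import Defs.
From HB Require Import structures.
From mathcomp Require Import all_boot all_order all_algebra all_field.
From mathcomp Require Import boolp mpoly zify.
Import GRing.Theory.
Local Open Scope ring_scope.
Set Implicit Arguments.
Unset Strict Implicit.
Unset Printing Implicit Defensive.

(* Following Kempf, weight the linear forms of a coordinate system so that every
   monomial of f has weight at least D.  A slice decomposition of length r over
   the algebraic closure gives such a weighting of total weight r D; conversely,
   the forms of weight at least D / d generate an ideal containing f, and there
   are at most d r of them when the total weight is at most r D.  Weightings of
   minimal (strictly convex) cost are nearly unique, because two of them can be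
   averaged in a common adapted basis.  Hence the span of the heavy forms is
   stable under conjugation and is defined over the perfect base field.  Integral
   weights with large D keep all minima attained; the approximation errors are
   absorbed by choosing a threshold in a gap between the weights.

   For a collection, the span of all coefficient vectors whose combination has
   slice rank at most r is stable under conjugation, so it contains a nonzero
   vector over the base field, which is a combination of at most s of them. *)

(** * Conjugate embeddings and descent of subspaces *)

(** Normalise a nonzero annihilating polynomial of least degree: in any factorisation one factor
    kills z and already has full degree. *)
Lemma algebraic_minpoly (E F : fieldType) (j : {rmorphism E -> F}) (z : F) :
  algebraicOver j z ->
  exists p : {poly E}, monic_irreducible_poly p /\ root (map_poly j p) z.
Proof.
case=> q0 q0_neq0 q0z.
pose P m := `[< exists q : {poly E},
  [/\ q != 0, root (map_poly j q) z & size q = m] >].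
have exP : exists m, P m by exists (size q0); apply/asboolP; exists q0.
case: (ex_minnP exP) => m /asboolP[q1 [q1_neq0 q1z sz_q1]] min_m.
have lc_neq0 : (lead_coef q1)^-1 != 0 by rewrite invr_eq0 lead_coef_eq0.
pose q := (lead_coef q1)^-1 *: q1.
have qz : root (map_poly j q) z by rewrite map_polyZ rootZ // fmorph_eq0.
have q_mon : q \is monic by rewrite monicE lead_coefZ mulVf ?lead_coef_eq0.
have min_q r : r != 0 -> root (map_poly j r) z -> (size q <= size r)%N.
  move=> r_neq0 rz; rewrite size_scale // sz_q1; apply: min_m.
  by apply/asboolP; exists r.
have q_neq0 := monic_neq0 q_mon.
exists q; split=> //; split=> //; split.
  rewrite ltnNge; apply/negP => /size1_polyC q_const; move: qz q_neq0.
  by rewrite q_const map_polyC rootC fmorph_eq0 => /eqP->; rewrite eqxx.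
move=> r szr r_dvd; have /dvdpP[u Dq] := r_dvd.
have /andP[u_neq0 r_neq0] : (u != 0) && (r != 0).
  by rewrite -negb_or -mulf_eq0 -Dq.
rewrite -dvdp_size_eqp // eqn_leq dvdp_leq //=.
move: qz; rewrite Dq rmorphM rootM => /orP[uz|rz]; last by rewrite -Dq min_q.
have := min_q u u_neq0 uz; rewrite Dq size_mul //.
have : size r != 0%N by rewrite size_poly_eq0.
have : size u != 0%N by rewrite size_poly_eq0.
have : size r != 1%N by [].
move: (size u) (size r) => a b; clear; lia.
Qed.

(** Evaluation at a root of p does not see reduction modulo p; this makes evaluation multiplicative
    on the quotient field. *)
Lemma qpoly_evalE (E F : fieldType) (j : {rmorphism E -> F}) (p : {poly E})
    (p_irr : monic_irreducible_poly p) (z : F) (q : {poly E}) :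
  root (map_poly j p) z ->
  (map_poly j (Pdiv.CommonRing.rmodp q (mk_monic p))).[z] = (map_poly j q).[z].
Proof.
move=> /rootP pz; rewrite [in RHS](Pdiv.RingMonic.rdivp_eq (monic_mk_monic p) q).
by rewrite rmorphD rmorphM hornerD hornerM mk_monicE // pz mulr0 add0r.
Qed.

Lemma qfpoly_eval (E F : fieldType) (j : {rmorphism E -> F}) (p : {poly E})
    (p_irr : monic_irreducible_poly p) (z : F) : root (map_poly j p) z ->
  exists e : {rmorphism {poly %/ p with p_irr} -> F},
    (forall x : E, e (qpolyC p x) = j x) /\ e (in_qpoly p 'X) = z.
Proof.
move=> pz.
pose ev (x : {poly %/ p with p_irr}) := (map_poly j (\val x)).[z].
have evB : {morph ev : x y / x - y >-> x - y}.
  by move=> x y; rewrite /ev !raddfB /= hornerD hornerN.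
have evM : {morph ev : x y / x * y >-> x * y}.
  by move=> x y; rewrite /ev /= qpoly_evalE // rmorphM hornerM.
have ev1 : ev 1 = 1.
  by rewrite /ev /= map_polyC hornerC; apply: rmorph1.
pose eA := GRing.isZmodMorphism.Build _ _ ev evB.
pose eM := GRing.isMonoidMorphism.Build _ _ ev (conj ev1 evM).
pose e : {rmorphism {poly %/ p with p_irr} -> F} := HB.pack ev eA eM.
exists e; split=> [x|].
  by rewrite /e /= /ev /= map_polyC hornerC.
by rewrite /e /= /ev /= qpoly_evalE // map_polyX hornerX.
Qed.

(** Adjoin to E a root of the minimal polynomial p of z: [j] extends by sending it to z, [sigma] by
    sending it to any root of the [sigma]-image of p. Such pairs of embeddings stand in for
    automorphisms of F. *)
Lemma embedding_step (E : fieldType) (F : closedFieldType)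
    (j sigma : {rmorphism E -> F}) (z : F) : algebraicOver j z ->
  exists (E' : fieldType) (i : {rmorphism E -> E'})
         (j' sigma' : {rmorphism E' -> F}),
    [/\ forall x, j' (i x) = j x, forall x, sigma' (i x) = sigma x
      & exists y, j' y = z].
Proof.
move=> /algebraic_minpoly[p [p_irr pz]].
have [z' pz']: exists z', root (map_poly sigma p) z'.
  apply/closed_rootP; rewrite size_map_poly.
  by case: p_irr => [[/ltn_eqF/negbT]]; rewrite eq_sym.
have [j' [j'E j'z]] := qfpoly_eval p_irr pz.
have [sigma' [sigma'E _]] := qfpoly_eval p_irr pz'.
pose i : {rmorphism E -> {poly %/ p with p_irr}} := @qpolyC E p.
by exists {poly %/ p with p_irr}, i, j', sigma'; split=> //; eexists; apply: j'z.
Qed.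

Lemma embedding_seq (k : fieldType) (F : closedFieldType)
    (iota : {rmorphism k -> F}) (s : seq F) (E : fieldType)
    (i : {rmorphism k -> E}) (j sigma : {rmorphism E -> F}) :
  (forall x : F, algebraicOver iota x) -> (forall x, j (i x) = iota x) ->
  exists (E' : fieldType) (i' : {rmorphism E -> E'})
         (j' sigma' : {rmorphism E' -> F}),
    [/\ forall x, j' (i' x) = j x, forall x, sigma' (i' x) = sigma x
      & forall z, z \in s -> exists y, j' y = z].
Proof.
move=> F_alg ji; elim: s => [|z s [E1 [i1 [j1 [sigma1 [j1E sigma1E s_im]]]]]].
  by exists E, idfun, j, sigma.
have z_alg : algebraicOver j1 z.
  have [p p_neq0 pz] := F_alg z.
  exists (map_poly (i1 \o i) p); first by rewrite map_poly_eq0.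
  rewrite -map_poly_comp; rewrite (eq_map_poly (g := iota)) // => x.
  by rewrite /= j1E ji.
have [E2 [i2 [j2 [sigma2 [j2E sigma2E [y yz]]]]]] := embedding_step sigma1 z_alg.
exists E2, (i2 \o i1), j2, sigma2; split=> [x|x|t]; rewrite ?inE /=.
- by rewrite j2E j1E.
- by rewrite sigma2E sigma1E.
by case/predU1P=> [->|/s_im[u <-]]; [exists y | exists (i2 u)].
Qed.

Lemma conjugate_root (k : fieldType) (F : closedFieldType)
    (iota : {rmorphism k -> F}) (p : {poly k}) (a : F) :
  separable_poly p -> root (map_poly iota p) a -> (2 < size p)%N ->
  exists2 b, root (map_poly iota p) b & b != a.
Proof.
move=> p_sep /factor_theorem[q Dq] sz_p.
have q_neq0 : q != 0.
  apply: contraTneq sz_p => q0; move/eqP: Dq.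
  by rewrite q0 mul0r map_poly_eq0 => /eqP->; rewrite size_poly0.
have [b qb] : exists b, root q b.
  apply/closed_rootP; have := size_map_poly iota p.
  rewrite Dq size_Mmonic ?monicXsubC // size_XsubC addn2 /= => Dsz.
  by move: sz_p; rewrite -Dsz; case: (size q) => [|[]].
exists b; first by rewrite Dq rootM qb.
apply: contraTneq qb => ->; move: p_sep.
by rewrite -(separable_map iota) Dq separable_root => /andP[].
Qed.

(** The minimal polynomial of an element a outside k has degree at least 2 and is separable, so it
    has a second root b. The embedding with a sent to b is then extended until the image of [j]
    contains s. *)
Lemma conjugation (k : fieldType) (F : closedFieldType)
    (iota : {rmorphism k -> F}) (a : F) (s : seq F) :
  perfect_field k -> (forall x : F, algebraicOver iota x) ->
  ~ (exists x, iota x = a) ->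
  exists (E : fieldType) (i : {rmorphism k -> E}) (j sigma : {rmorphism E -> F}),
    [/\ forall x, j (i x) = iota x, forall x, sigma (i x) = iota x,
        forall z, z \in s -> exists y, j y = z
      & exists2 y, j y = a & sigma y != a].
Proof.
move=> k_perfect F_alg a_notin.
have [p [p_irr pa]] := algebraic_minpoly (F_alg a).
have sz_p : (2 < size p)%N.
  have p_gt1 : (1 < size p)%N by case: p_irr => [[]].
  rewrite ltn_neqAle p_gt1 andbT eq_sym; apply/eqP => sz_p; apply: a_notin.
  exists (- p`_0); rewrite rmorphN; apply/esym/eqP.
  have lc_p : p`_1 = 1.
    by have /eqP : p \is monic := p_irr.2; rewrite /lead_coef sz_p.
  move/eqP: pa; rewrite horner_coef size_map_poly sz_p !big_ord_recl big_ord0.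
  rewrite /= expr0 expr1 mulr1 addr0 !coef_map /= lc_p rmorph1 mul1r addrC.
  by move/eqP; rewrite addr_eq0.
have [b pb b_neq] := conjugate_root (k_perfect p p_irr.1) pa sz_p.
have [j0 [j0E j0X]] := qfpoly_eval p_irr pa.
have [sigma0 [sigma0E sigma0X]] := qfpoly_eval p_irr pb.
pose i0 : {rmorphism k -> {poly %/ p with p_irr}} := @qpolyC k p.
have [E [i [j [sigma [jE sigmaE s_im]]]]] :=
  embedding_seq s sigma0 (i := i0) F_alg j0E.
exists E, (i \o i0), j, sigma; split=> // [x|x|] /=.
- by rewrite jE -j0E.
- by rewrite sigmaE -sigma0E.
- exists (i (in_qpoly p 'X)); first by rewrite jE j0X.
  by rewrite sigmaE sigma0X.
Qed.

(** * Descent of row spaces through echelon forms *)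

Lemma image_matrix (E F : Type) (j : E -> F) (m n : nat) (A : 'M[F]_(m, n)) :
  (forall a b, exists y, j y = A a b) -> exists A0, map_mx j A0 = A.
Proof.
move=> A_im; have /choice[g gE] : forall q : 'I_m * 'I_n, exists y, j y = A q.1 q.2.
  by case.
exists (\matrix_(a, b) g (a, b)).
by apply/matrixP=> a b; rewrite !mxE gE.
Qed.

Definition mx_entries (F : eqType) (m n : nat) (A : 'M[F]_(m, n)) : seq F :=
  [seq A q.1 q.2 | q : 'I_m * 'I_n].

Lemma image_mx_entries (E : Type) (F : eqType) (j : E -> F) (m n : nat)
    (A : 'M[F]_(m, n)) :
  (forall z, z \in mx_entries A -> exists y, j y = z) ->
  exists A0, map_mx j A0 = A.
Proof.
move=> A_im; apply: image_matrix => a b; apply: A_im.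
exact: (image_f (fun q : 'I_m * 'I_n => A q.1 q.2) (x := (a, b))).
Qed.

Lemma unit_colsub (F : fieldType) (m n : nat) (B : 'M[F]_(m, n)) :
  row_free B -> exists f : 'I_m -> 'I_n, mxsub id f B \in unitmx.
Proof.
move=> B_free; have B_full : row_full B^T by rewrite /row_full mxrank_tr.
exists (fullrankfun B_full).
by have := fullrowsub_unit B_full; rewrite -trmx_mxsub unitmx_tr.
Qed.

(** Normalising by a block of columns cancels a change of basis U; in the application C is a column
    block of B. *)
Lemma echelon_invariant (F : fieldType) (m n : nat) (U C : 'M[F]_m)
    (B : 'M[F]_(m, n)) :
  U *m C \in unitmx -> invmx (U *m C) *m (U *m B) = invmx C *m B.
Proof.
move=> UC_unit; have := UC_unit; rewrite unitmx_mul => /andP[U_unit C_unit].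
rewrite -[LHS](mulKmx C_unit); congr (_ *m _).
by rewrite -[LHS](mulKmx U_unit) (mulmxA U) mulKVmx // mulKmx.
Qed.

(* An echelon form of W depends only on its row space and commutes with field
   embeddings, so its entries are fixed by all conjugations. *)
Lemma descent_submx (k : fieldType) (F : closedFieldType)
    (iota : {rmorphism k -> F}) (m n : nat) (W : 'M[F]_(m, n)) (s : seq F) :
  perfect_field k -> (forall x : F, algebraicOver iota x) ->
  (forall (E : fieldType) (i : {rmorphism k -> E})
      (j sigma : {rmorphism E -> F}) (W0 : 'M[E]_(m, n)),
    (forall x, j (i x) = iota x) -> (forall x, sigma (i x) = iota x) ->
    (forall z, z \in s -> exists y, j y = z) ->
    map_mx j W0 = W -> (map_mx sigma W0 == W)%MS) ->
  exists R : 'M[k]_(\rank W, n), (map_mx iota R == W)%MS.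
Proof.
move=> k_perfect F_alg W_inv; pose B := row_base W.
have [f C_unit] := unit_colsub (row_base_free W : row_free B).
pose C := mxsub id f B; pose R := invmx C *m B.
have R_W : (R == W)%MS.
  by apply/eqmxP/(eqmx_trans _ (eq_row_base W))/eqmxMfull; rewrite row_full_unit unitmx_inv.
suff /image_matrix[R0 R0E] : forall u v, exists x, iota x = R u v.
  by exists R0; rewrite R0E.
(* An entry outside k would be moved by some [sigma]. As W and B both come from E, invariance of W
   makes [sigma] send [R0] to R again, just as [j] does. *)
move=> u v; apply: contrapT => /(conjugation
  (s ++ mx_entries W ++ mx_entries B) k_perfect F_alg).
case=> E [i [j [sigma [ji sigmai im [y jy sigmay]]]]].
have [|W0 W0E] := @image_mx_entries _ _ j _ _ W.
  by move=> z z_W; apply: im; rewrite !mem_cat z_W orbT.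
have [|B0 B0E] := @image_mx_entries _ _ j _ _ B.
  by move=> z z_B; apply: im; rewrite !mem_cat z_B !orbT.
have /eqmxP sW : (map_mx sigma W0 == W)%MS.
  by apply: (W_inv _ _ _ _ _ ji sigmai _ W0E) => z z_s; apply: im;
    rewrite mem_cat z_s.
have BW0 : (B0 :=: W0)%MS.
  by apply/(map_eqmx j); rewrite W0E B0E; apply: eq_row_base.
have /submxP[U UE] : (map_mx sigma B0 <= B)%MS.
  by rewrite eq_row_base -sW map_submx BW0.
pose C0 := mxsub id f B0.
have C0_unit : C0 \in unitmx by rewrite -(map_unitmx j) map_mxsub B0E.
pose R0 := invmx C0 *m B0.
have jR0 : map_mx j R0 = R by rewrite map_mxM map_invmx map_mxsub B0E.
have sigmaC0 : map_mx sigma C0 = U *m C by rewrite map_mxsub UE mulmx_colsub.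
have sigmaR0 : map_mx sigma R0 = R.
  rewrite map_mxM map_invmx sigmaC0 UE echelon_invariant //.
  by rewrite -sigmaC0 map_unitmx.
have y_R0 : y = R0 u v by apply: (fmorph_inj j); rewrite jy -jR0 mxE.
by case/eqP: sigmay; rewrite y_R0 -sigmaR0 [RHS]mxE.
Qed.

(** * Linear substitutions and weights *)

Section LinearSubstitution.
Variables (K : fieldType) (n : nat).
Implicit Types (f g p q : {mpoly K[n]}) (A B P L : 'M[K]_n).

Definition linform (v : 'rV[K]_n) : {mpoly K[n]} := \sum_k v 0 k *: 'X_k.

(** Row i of A is the image of ['X_i], so successive substitutions multiply their matrices from left
    to right. *)
Definition lsubst A f : {mpoly K[n]} :=
  f \mPo [tuple linform (row i A) | i < n].

HB.instance Definition _ A := GRing.RMorphism.copy (lsubst A)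
  (comp_mpoly [tuple linform (row i A) | i < n]).
HB.instance Definition _ A := GRing.Linear.copy (lsubst A)
  (comp_mpoly [tuple linform (row i A) | i < n]).

Lemma linform_is_linear : linear linform.
Proof.
move=> a u v; rewrite /linform scaler_sumr -big_split /=.
by apply: eq_bigr => k _; rewrite !mxE scalerDl scalerA.
Qed.
HB.instance Definition _ := GRing.isLinear.Build K _ _ _ linform linform_is_linear.

Lemma linform_dhomog v : linform v \is 1.-homog.
Proof. by apply: rpred_sum => k _; apply: rpredZ; rewrite dhomogX /= mdeg1. Qed.

Lemma lsubstXU A i : lsubst A 'X_i = linform (row i A).
Proof. by rewrite /lsubst comp_mpolyXU -tnth_nth tnth_mktuple. Qed.

Lemma lsubstX A m : lsubst A 'X_[m] = \prod_i linform (row i A) ^+ m i.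
Proof.
by rewrite /lsubst comp_mpolyX; apply: eq_bigr => i _; rewrite tnth_mktuple.
Qed.

Lemma lsubstE A f :
  lsubst A f = \sum_(m <- msupp f) f@_m *: \prod_i linform (row i A) ^+ m i.
Proof.
rewrite {1}[f]mpolyE linear_sum; apply: eq_bigr => m _.
by rewrite linearZ_LR /= lsubstX.
Qed.

Lemma linform_row1 i : linform (row i 1%:M) = 'X_i.
Proof.
rewrite /linform (bigD1 i) //= !mxE eqxx scale1r big1 ?addr0 // => k k_neq.
by rewrite !mxE eq_sym (negPf k_neq) scale0r.
Qed.

Lemma lsubst1 f : lsubst 1%:M f = f.
Proof.
rewrite lsubstE [RHS]mpolyE; apply: eq_bigr => m _; congr (_ *: _).
rewrite [RHS]mpolyXE_id; apply: eq_bigr => i _; congr (_ ^+ _).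
exact: linform_row1.
Qed.

Lemma lsubst_linform A v : lsubst A (linform v) = linform (v *m A).
Proof.
rewrite raddf_sum mulmx_sum_row linear_sum; apply: eq_bigr => k _.
by rewrite [LHS]linearZ_LR /= lsubstXU [RHS]linearZ_LR.
Qed.

Lemma lsubst_comp A B f : lsubst B (lsubst A f) = lsubst (A *m B) f.
Proof.
rewrite (lsubstE A) linear_sum [RHS]lsubstE; apply: eq_bigr => m _.
rewrite linearZ_LR /= rmorph_prod; congr (_ *: _); apply: eq_bigr => i _.
by rewrite rmorphXn /= lsubst_linform row_mul.
Qed.

Lemma dhomog_bigprod (e : 'I_n -> nat) (F : 'I_n -> {mpoly K[n]}) :
  (forall i, F i \is (e i).-homog) -> \prod_i F i \is (\sum_i e i).-homog.
Proof.
move=> F_homog; elim/big_rec2: _ => [|i d p _ p_homog]; first exact: dhomog1.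
exact: dhomogM.
Qed.

Lemma lsubst_dhomog A d f : f \is d.-homog -> lsubst A f \is d.-homog.
Proof.
move=> /dhomogP f_homog; rewrite lsubstE big_seq.
apply: rpred_sum => m /f_homog <-; apply: rpredZ; rewrite /= mdegE.
apply: dhomog_bigprod => i; rewrite -[X in X.-homog]mul1n.
exact/dhomogMn/linform_dhomog.
Qed.

(** * Weights of monomials and their behaviour under substitution *)

Definition wdeg (w : 'I_n -> nat) (m : 'X_{1..n}) : nat := \sum_i m i * w i.

Definition wge (w : 'I_n -> nat) (D : nat) f : Prop :=
  forall m, m \in msupp f -> (D <= wdeg w m)%N.

Implicit Types w : 'I_n -> nat.

Lemma wge1 w : wge w 0 1.
Proof. by []. Qed.

Lemma wge_sum w D (I : eqType) (r : seq I) (F : I -> {mpoly K[n]}) :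
  (forall i, i \in r -> wge w D (F i)) -> wge w D (\sum_(i <- r) F i).
Proof.
move=> F_ge m /msupp_sum_le /flattenP[_ /mapP[i + ->]].
by rewrite filter_predT => /F_ge; apply.
Qed.

Lemma wgeZ w D a f : wge w D f -> wge w D (a *: f).
Proof. by move=> f_ge m /msuppZ_le /f_ge. Qed.

Lemma wgeM w D E f g : wge w D f -> wge w E g -> wge w (D + E) (f * g).
Proof.
move=> f_ge g_ge m /msuppM_le /allpairsP[[a b] /= [/f_ge a_ge /g_ge b_ge ->]].
apply: leq_trans (leq_add a_ge b_ge) _; rewrite -big_split /=.
by apply: leq_sum => i _; rewrite mnmDE mulnDl.
Qed.

Lemma wge_exp w D f e : wge w D f -> wge w (e * D) (f ^+ e).
Proof.
move=> f_ge; elim: e => [|e IHe]; first exact: wge1.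
by rewrite exprS mulSn; apply: wgeM.
Qed.

Lemma wge_prod w (e : 'I_n -> nat) (F : 'I_n -> {mpoly K[n]}) :
  (forall i, wge w (e i) (F i)) -> wge w (\sum_i e i) (\prod_i F i).
Proof.
move=> F_ge; elim/big_rec2: _ => [|i d p _ p_ge]; first exact: wge1.
exact: wgeM.
Qed.

(** A block triangularity condition: each variable is replaced by a form in variables at least as
    heavy, so substitution does not lower weights. *)
Definition wcompat (w w' : 'I_n -> nat) A : Prop :=
  forall i j, A i j != 0 -> (w i <= w' j)%N.

Lemma wge_linform w D (v : 'rV[K]_n) :
  (forall k, v 0 k != 0 -> (D <= w k)%N) -> wge w D (linform v).
Proof.
move=> v_ge; apply: wge_sum => k _ m.
have [->|/v_ge k_ge] := eqVneq (v 0 k) 0; first by rewrite scale0r msupp0.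
move=> /msuppZ_le; rewrite msuppX inE => /eqP->.
rewrite /wdeg (bigD1 k) //= mnm1E eqxx mul1n.
exact: leq_trans (leq_addr _ _).
Qed.

Lemma wge_lsubst w w' D A f :
  wcompat w w' A -> wge w D f -> wge w' D (lsubst A f).
Proof.
move=> A_compat f_ge; rewrite lsubstE; apply: wge_sum => m m_f.
apply: wgeZ; suff X_ge : wge w' (wdeg w m) (\prod_i linform (row i A) ^+ m i).
  by move=> m' /X_ge; apply: leq_trans; apply: f_ge.
apply: wge_prod => i; apply: wge_exp; apply: wge_linform => k.
by rewrite mxE => /A_compat.
Qed.

(** Monomial weights are additive in the weighting, so two lower bounds average. *)
Lemma wge_mean w v u D f : wge w D f -> wge v D f ->
  (forall i, (w i + v i <= 2 * u i)%N) -> wge u D f.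
Proof.
move=> w_ge v_ge wvu m m_f; rewrite -(leq_pmul2l (isT : (0 < 2)%N)).
rewrite mul2n -addnn; apply: leq_trans (leq_add (w_ge _ m_f) (v_ge _ m_f)) _.
rewrite -big_split /= big_distrr /=; apply: leq_sum => i _.
by rewrite -mulnDr mulnCA leq_mul2l wvu orbT.
Qed.

(** A monomial of degree d > 0 in variables lighter than t weighs less than t d. Hence every
    monomial of f contains a variable of weight at least t, which P kills. *)
Lemma lsubst_eq0 w D d t P f : (0 < d)%N -> (t * d <= D)%N ->
  f \is d.-homog -> wge w D f ->
  (forall i, (t <= w i)%N -> row i P = 0) -> lsubst P f = 0.
Proof.
move=> d_gt0 td_le /dhomogP f_homog f_ge P0; rewrite lsubstE big_seq.
apply: big1 => m m_f.
have [/existsP[i /andP[mi_gt0 wi_ge]]|/existsPn small] :=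
    boolP [exists i, (0 < m i) && (t <= w i)]%N.
  rewrite (bigD1 i) //= P0 // [linform 0]linear0 expr0n.
  by rewrite eqn0Ngt mi_gt0 mul0r scaler0.
have := f_ge m m_f; rewrite leqNgt => /negP[].
apply: leq_trans td_le; rewrite -(f_homog m m_f) /= mdegE mulnC.
rewrite big_distrl /=; have /existsP[i0 mi0] : [exists i, 0 < m i]%N.
  apply: contraTT d_gt0 => /existsPn m0; rewrite -(f_homog m m_f) /= mdegE.
  by rewrite big1 // => i _; apply/eqP; rewrite eqn0Ngt.
have lt_i i : (0 < m i)%N -> (w i < t)%N.
  by move=> mi; have := small i; rewrite mi /= ltnNge.
rewrite /wdeg (bigD1 i0) //= [X in (_ < X)%N](bigD1 i0) //= -addSn leq_add //.
  by rewrite ltn_pmul2l // lt_i.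
apply: leq_sum => i _; have [->|/lt_i/ltnW] := posnP (m i); first by [].
by rewrite leq_mul2l => ->; rewrite orbT.
Qed.

(** [copid_mx r] kills the first r variables and fixes the others, so each monomial of f contains
    one of the first r, and that one alone weighs D. *)
Lemma wge_copid (r D : nat) f : lsubst (copid_mx r) f = 0 ->
  wge (fun i => if (i < r)%N then D else 0%N) D f.
Proof.
move=> f0 m m_f.
have [/existsP[i /andP[mi_gt0 i_lt]]|/existsPn small] :=
    boolP [exists i, (0 < m i) && (i < r)]%N.
  rewrite /wdeg (bigD1 i) //= i_lt; apply: leq_trans (leq_addr _ _).
  exact: leq_pmull.
have row_copid i : linform (row i (copid_mx r)) = if (i < r)%N then 0 else 'X_i.
  rewrite -linform_row1; case: ifP => i_r.
    rewrite -[RHS](linear0 linform); congr linform; apply/rowP=> j; rewrite !mxE.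
    by rewrite i_r andbT subrr.
  congr linform; apply/rowP=> j; rewrite !mxE i_r andbF.
  by rewrite subr0.
(* As m avoids the first r variables, m itself is the only monomial whose image contributes to the
   coefficient at m. *)
have term (m' : 'X_{1..n}) : (\prod_i linform (row i (copid_mx r)) ^+ m' i)@_m = (m' == m)%:R.
  have [/existsP[i /andP[m'i_gt0 i_lt]]|/existsPn small'] :=
      boolP [exists i, (0 < m' i) && (i < r)]%N.
    rewrite (bigD1 i) //= row_copid i_lt expr0n eqn0Ngt m'i_gt0 mul0r mcoeff0.
    case: eqP => // m'm; have := small i.
    by rewrite -m'm m'i_gt0 i_lt.
  rewrite -mcoeffX mpolyXE_id; congr (_@__); apply: eq_bigr => i _.
  rewrite row_copid; case: ifP => // i_lt; have := small' i.
  by rewrite i_lt andbT -eqn0Ngt => /eqP->.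
move: m_f; rewrite mcoeff_msupp => /negP[]; apply/eqP.
have /(congr1 (mcoeff m)) := f0; rewrite lsubstE mcoeff0 raddf_sum /=.
under eq_bigr do rewrite mcoeffZ term.
have [m_f|m_nf] := boolP (m \in msupp f); last by rewrite (memN_msupp_eq0 m_nf).
rewrite (bigD1_seq m) //= eqxx mulr1 big1 ?addr0 // => m' m'_neq.
by rewrite (negPf m'_neq) mulr0.
Qed.

(** From L P = 0 follows P = (1 - pinvmx L L) P, so substitution by P factors through the
    projector. *)
Lemma lsubst_pinv_eq0 (m : nat) (L : 'M[K]_(m, n)) P f : L *m P = 0 ->
  lsubst (1%:M - pinvmx L *m L) f = 0 -> lsubst P f = 0.
Proof.
move=> LP0 f0; rewrite -[P]mul1mx -[1%:M](subrK (pinvmx L *m L)) mulmxDl.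
by rewrite -mulmxA LP0 mulmx0 addr0 -lsubst_comp f0 linear0.
Qed.

Lemma mul_pinv_eq0 (m : nat) (L : 'M[K]_(m, n)) :
  L *m (1%:M - pinvmx L *m L) = 0.
Proof. by rewrite mulmxBr mulmx1 mulmxA mulmxKpV // subrr. Qed.

(** Modulo the ideal of the [l t] every variable is congruent to its image under P; both sides being
    ring morphisms, so is every polynomial. *)
Lemma ideal_subst (r : nat) (l : 'I_r -> {mpoly K[n]}) P f :
  (forall i, exists a : 'I_r -> K, linform (row i (1%:M - P)) = \sum_t a t *: l t) ->
  exists g : 'I_r -> {mpoly K[n]}, f - lsubst P f = \sum_t l t * g t.
Proof.
move=> lin_in.
pose I h := exists g : 'I_r -> {mpoly K[n]}, h = \sum_t l t * g t.
have I0 : I 0 by exists (fun=> 0); rewrite big1 // => t _; rewrite mulr0.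
have IM h q : I h -> I (h * q).
  case=> g ->; exists (fun t => g t * q); rewrite mulr_suml.
  by apply: eq_bigr => t _; rewrite mulrA.
have ID h h' : I h -> I h' -> I (h + h').
  case=> g -> [g' ->]; exists (fun t => g t + g' t); rewrite -big_split /=.
  by apply: eq_bigr => t _; rewrite mulrDr.
have I_lin i : I ('X_i - lsubst P 'X_i).
  have [a aE] := lin_in i; exists (fun t => (a t)%:MP).
  rewrite lsubstXU -linform_row1 -linearB -linearB /= aE.
  by apply: eq_bigr => t _; rewrite mulrC mul_mpolyC.
have I_mul p q : I (p - lsubst P p) -> I (q - lsubst P q) ->
    I (p * q - lsubst P (p * q)).
  move=> Ip Iq; rewrite rmorphM /=.
  rewrite (_ : _ - _ = (p - lsubst P p) * q + (q - lsubst P q) * lsubst P p).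
    by apply: ID; apply: IM.
  by rewrite !mulrBl [q * _]mulrC addrA subrK [lsubst P q * _]mulrC.
have I_prod (F : 'I_n -> {mpoly K[n]}) : (forall i, I (F i - lsubst P (F i))) ->
    I (\prod_i F i - lsubst P (\prod_i F i)).
  move=> IF; elim/big_ind: _ => //.
  by rewrite rmorph1 subrr.
have I_exp p e : I (p - lsubst P p) -> I (p ^+ e - lsubst P (p ^+ e)).
  move=> Ip; elim: e => [|e IHe]; first by rewrite expr0 rmorph1 subrr.
  by rewrite exprS; apply: I_mul.
elim/mpolyind: f => [|c m p _ _ Ip]; first by rewrite linear0 subrr.
rewrite linearD opprD addrACA; apply: ID => //.
rewrite -mul_mpolyC; apply: I_mul.
  by rewrite /lsubst comp_mpolyC subrr.
by rewrite mpolyXE_id; apply: I_prod => i; apply: I_exp.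
Qed.

(** Serves to replace the cofactors of linear forms by their homogeneous components. *)
Lemma pihomogM_linear d p q : p \is 1.-homog ->
  pihomog mdeg d.+1 (p * q) = p * pihomog mdeg d q.
Proof.
move=> /dhomogP p_homog.
elim/mpolyind: q => [|c m q _ _ IHq]; first by rewrite mulr0 !pihomog0 mulr0.
rewrite mulrDr !pihomogD IHq mulrDr; congr (_ + _).
rewrite -scalerAr linearZ_LR [in RHS]linearZ_LR -scalerAr /=; congr (_ *: _).
rewrite [p]mpolyE mulr_suml linear_sum mulr_suml big_seq [RHS]big_seq /=.
apply: eq_bigr => m' /p_homog /= deg_m'.
rewrite -!scalerAl linearZ_LR /= -mpolyXD !pihomogX /= mdegD deg_m' add1n eqSS.
by case: ifP => _; rewrite ?mpolyXD ?mulr0.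
Qed.
End LinearSubstitution.

(** * Slice rank as vanishing on a subspace *)

Lemma map_linform (E F : fieldType) (j : {rmorphism E -> F}) (n : nat)
    (v : 'rV[E]_n) : map_mpoly j (linform v) = linform (map_mx j v).
Proof.
rewrite /linform raddf_sum; apply: eq_bigr => k _.
by rewrite /= map_mpolyZ map_mpolyX mxE.
Qed.

Lemma map_lsubst (E F : fieldType) (j : {rmorphism E -> F}) (n : nat)
    (A : 'M[E]_n) (f : {mpoly E[n]}) :
  map_mpoly j (lsubst A f) = lsubst (map_mx j A) (map_mpoly j f).
Proof.
rewrite /lsubst map_mpoly_comp; last exact: fmorph_inj.
congr (_ \mPo _); apply: eq_from_tnth => i.
by rewrite tnth_map !tnth_mktuple map_linform map_row.
Qed.

Lemma map_mpoly_eq0 (E F : fieldType) (j : {rmorphism E -> F}) (n : nat)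
    (f : {mpoly E[n]}) : (map_mpoly j f == 0) = (f == 0).
Proof.
apply/eqP/eqP => [jf0|->]; last exact: raddf0.
apply/mpolyP => m; apply: (fmorph_inj j).
by rewrite -mcoeff_map_mpoly jf0 !mcoeff0 rmorph0.
Qed.

Lemma map_mpoly_dhomog (E F : fieldType) (j : {rmorphism E -> F}) (n d : nat)
    (f : {mpoly E[n]}) : f \is d.-homog -> map_mpoly j f \is d.-homog.
Proof.
move=> /dhomogP f_homog; apply/dhomogP => m.
by rewrite (perm_mem (msupp_map_mpoly _ (fmorph_inj j))); apply: f_homog.
Qed.

Lemma wge_map (E F : fieldType) (j : {rmorphism E -> F}) (n D : nat)
    (w : 'I_n -> nat) (f : {mpoly E[n]}) : wge w D (map_mpoly j f) <-> wge w D f.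
Proof.
split=> f_ge m; have supp := perm_mem (msupp_map_mpoly f (fmorph_inj j)).
  by rewrite -supp; apply: f_ge.
by rewrite supp; apply: f_ge.
Qed.

Lemma map_mpoly_id_comp (k E F : fieldType) (iota : {rmorphism k -> F})
    (i : {rmorphism k -> E}) (j : {rmorphism E -> F}) (n : nat)
    (f : {mpoly k[n]}) : (forall x, j (i x) = iota x) ->
  map_mpoly j (map_mpoly i f) = map_mpoly iota f.
Proof. by move=> ji; apply/mpolyP => m; rewrite !mcoeff_map_mpoly /= ji. Qed.

(* As 1 - pinvmx L *m L projects onto the common zeros of the linear forms given
   by the rows of L, this says that f lies in the ideal they generate. *)
Definition vanishes_on (K : fieldType) (m n : nat) (L : 'M[K]_(m, n))
    (f : {mpoly K[n]}) : Prop := lsubst (1%:M - pinvmx L *m L) f = 0.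

Section SliceRank.
Variables (K : fieldType) (n : nat).
Implicit Types (f : {mpoly K[n]}) (P : 'M[K]_n).

Lemma vanishes_onP (m : nat) (L : 'M[K]_(m, n)) f :
  vanishes_on L f <-> forall P, L *m P = 0 -> lsubst P f = 0.
Proof.
split=> [f0 P LP0|]; first exact: lsubst_pinv_eq0 LP0 f0.
by apply; apply: mul_pinv_eq0.
Qed.

Lemma vanishes_onS (m m' : nat) (L : 'M[K]_(m, n)) (L' : 'M[K]_(m', n)) f :
  (L <= L')%MS -> vanishes_on L f -> vanishes_on L' f.
Proof.
move=> /submxP[U ->] /vanishes_onP f0; apply/vanishes_onP => P LP0.
by apply: f0; rewrite -mulmxA LP0 mulmx0.
Qed.

Lemma linform_of_dhomog (l : {mpoly K[n]}) : l \is 1.-homog ->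
  l = linform (\row_k l@_U_(k)).
Proof.
move=> l_homog; apply/mpolyP => m; rewrite raddf_sum /=.
under eq_bigr do rewrite mxE mcoeffZ mcoeffX.
have [m1|m_n1] := eqVneq (mdeg m) 1%N; last first.
  rewrite (dhomog_nemf_coeff l_homog m_n1) big1 // => k _.
  by case: eqP => [km|]; rewrite ?mulr0 //; case/eqP: m_n1; rewrite -km mdeg1.
have /mdeg1P[k /eqP->] : (mdeg m == 1)%N by apply/eqP.
rewrite (bigD1 k) //= eqxx mulr1 big1 ?addr0 // => k' k'_neq.
by rewrite eq_mnm1 ?(negPf k'_neq) ?mulr0.
Qed.

Lemma slice_rank_le (d m : nat) (L : 'M[K]_(m, n)) f : (0 < d)%N ->
  f \is d.-homog -> vanishes_on L f -> (slice_rank f <= \rank L)%N.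
Proof.
case: d => // d _ f_homog f0; suff f_dec : slice_decomposition f (\rank L).
  by apply: (natinf_spec _).2 => //; exists (\rank L).
(* The cofactor degree is read off [msize f], which reflects d for nonzero f; 0 is treated apart. *)
have [f_eq0|f_neq0] := eqVneq f 0.
  exists (fun=> 0), (fun=> 0); split=> [_|_|]; rewrite ?rpred0 //.
  by rewrite big1 // => t _; rewrite mulr0.
have deg_f : (msize f).-2 = d.
  by rewrite -(dhomog_uniq f_neq0 f_homog (dhomog_msize f_homog)).
pose l t := linform (row t (row_base L)).
have [i|g fE] := @ideal_subst K n _ l (1%:M - pinvmx L *m L) f.
  rewrite opprB addrCA subrr addr0 row_mul.
  have /submxP[a ->] : (row i (pinvmx L) *m L <= row_base L)%MS.
    by rewrite eq_row_base submxMl.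
  exists (fun t => a 0 t); rewrite mulmx_sum_row linear_sum /=.
  by apply: eq_bigr => t _; rewrite linearZ_LR.
exists l, (fun t => pihomog mdeg d (g t)); split=> [t|t|].
- exact: linform_dhomog.
- by rewrite deg_f; apply: pihomogP.
rewrite -[LHS](pihomog_dE f_homog); rewrite f0 subr0 in fE.
rewrite fE raddf_sum; apply: eq_bigr => t _ /=.
by rewrite pihomogM_linear //; apply: linform_dhomog.
Qed.

Lemma slice_rank_ex (d : nat) f : (0 < d)%N -> f \is d.-homog ->
  exists L : 'M[K]_n, (\rank L <= slice_rank f)%N /\ vanishes_on L f.
Proof.
move=> d_gt0 f_homog.
have [[l [g [l_homog _ fE]]] _] :=
  natinf_spec (slice_decomposition_ex d_gt0 f_homog).
pose L0 : 'M_(slice_rank f, n) := \matrix_(t, k) (l t)@_U_(k).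
(* The rows of [L0] are the linear forms of a minimal decomposition; the brackets give a square
   matrix with the same row space. *)
exists <<L0>>%MS; rewrite genmxE rank_leq_row; split=> //.
apply: (@vanishes_onS _ _ L0); first by rewrite genmxE.
apply/vanishes_onP => P LP0; rewrite fE linear_sum big1 // => t _.
rewrite rmorphM /= [l t]linform_of_dhomog // lsubst_linform.
rewrite (_ : (\row_k _) = row t L0); last by apply/rowP => k; rewrite !mxE.
by rewrite -row_mul LP0 row0 [linform 0]linear0 mul0r.
Qed.

Lemma slice_rank_sum (I : eqType) (s : seq I) (c : I -> K)
    (F : I -> {mpoly K[n]}) (d r : nat) : (0 < d)%N ->
  (forall a, a \in s -> F a \is d.-homog) ->
  (forall a, a \in s -> slice_rank (F a) <= r)%N ->
  (slice_rank (\sum_(a <- s) c a *: F a) <= size s * r)%N.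
Proof.
move=> d_gt0 F_homog F_le.
have [L [rkL L0]] : exists L : 'M[K]_n, (\rank L <= size s * r)%N /\
    vanishes_on L (\sum_(a <- s) c a *: F a).
  elim: s F_homog F_le => [|a s IHs] F_homog F_le.
    by exists 0; rewrite mxrank0; split=> //; rewrite big_nil; apply: linear0.
  have [||L [rkL L0]] := IHs; try by move=> b b_s; rewrite ?F_homog ?F_le // inE b_s orbT.
  have a_s : a \in a :: s by rewrite mem_head.
  have [La [rkLa La0]] := slice_rank_ex d_gt0 (F_homog a a_s).
  exists (La + L)%MS; split.
    rewrite mulSn (leq_trans (mxrank_adds_leqif _ _)) // leq_add //.
    exact: leq_trans rkLa (F_le a a_s).
  have/vanishes_onP La0' := vanishes_onS (addsmxSl La L) La0.
  have/vanishes_onP L0' := vanishes_onS (addsmxSr La L) L0.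
  apply/vanishes_onP => P LP0.
  by rewrite big_cons linearD linearZ_LR /= La0' // L0' // scaler0 addr0.
apply: leq_trans rkL; apply: (slice_rank_le d_gt0) L0.
by rewrite big_seq; apply: rpred_sum => a a_s; rewrite rpredZ ?F_homog.
Qed.
End SliceRank.

Lemma map_vanishes_on (E F : fieldType) (j : {rmorphism E -> F}) (m n : nat)
    (L : 'M[E]_(m, n)) (f : {mpoly E[n]}) :
  vanishes_on (map_mx j L) (map_mpoly j f) <-> vanishes_on L f.
Proof.
rewrite /vanishes_on -map_pinvmx -map_mxM -(map_mx1 j) -map_mxB -map_lsubst.
by split=> /eqP; [rewrite map_mpoly_eq0 => /eqP|move=> H; apply/eqP; rewrite map_mpoly_eq0].
Qed.

(** * Common adapted bases *)

(** The condition on r makes [delta_mx k 0 *m r] square to zero, so the inverse has a plus sign. *)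
Lemma column_step (K : fieldType) (n : nat) (k : 'I_n) (r : 'rV[K]_n) :
  r 0 k = 0 -> 1%:M - delta_mx k 0 *m r \in unitmx.
Proof.
move=> rk0; have rk : r *m delta_mx k (0 : 'I_1) = 0.
  apply/matrixP=> i j; rewrite [i]ord1 [j]ord1 !mxE (bigD1 k) //= rk0 mul0r.
  by rewrite big1 ?addr0 // => l l_k; rewrite mxE (negPf l_k) mulr0.
have : (1%:M - delta_mx k 0 *m r) *m (1%:M + delta_mx k 0 *m r) = 1%:M.
  rewrite mulmxDr mulmx1 mulmxBl mul1mx -(mulmxA _ r) (mulmxA r) rk mul0mx.
  by rewrite mulmx0 subr0 subrK.
by case/mulmx1_unit.
Qed.

Lemma mul_column_step (K : fieldType) (m n : nat) (X : 'M[K]_(m, n)) (k : 'I_n)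
    (r : 'rV[K]_n) i l :
  (X *m (1%:M - delta_mx k 0 *m r)) i l = X i l - X i k * r 0 l.
Proof.
rewrite mulmxBr mulmx1 mulmxA -colE !mxE; congr (_ - _).
by rewrite big_ord1 !mxE.
Qed.

(* Any two weighted bases admit a common adapted basis: column elimination in
   order of increasing w, with pivots of maximal w', as in the Bruhat
   decomposition. *)
Lemma common_basis (K : fieldType) (n : nat) (T : 'M[K]_n) (w w' : 'I_n -> nat) :
  T \in unitmx -> exists (M : 'M[K]_n) (pi : 'I_n -> 'I_n),
    [/\ M \in unitmx, injective pi, wcompat w w M
      & wcompat w' (w' \o pi) (T *m M)].
Proof.
move=> T_unit.
(* S holds the q columns processed so far, which are the lightest for w, and [pi] their pivot rows.
   Each pivot is heaviest for w' among the nonzero rows of its column, and pivot rows vanish outside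
   S. *)
suff elimination q : (q <= n)%N ->
    exists (S : {set 'I_n}) (M : 'M[K]_n) (pi : 'I_n -> 'I_n),
    [/\ #|S| = q, M \in unitmx, wcompat w w M, {in S &, injective pi} &
     [/\ forall k l, k \in S -> l \notin S -> (w k <= w l)%N,
         forall j k, k \in S -> (T *m M) j k != 0 -> (w' j <= w' (pi k))%N
       & forall k l, k \in S -> l \notin S -> (T *m M) (pi k) l = 0]].
  have [S [M [pi [S_full M_unit M_compat pi_inj [_ TM_S _]]]]] :=
    elimination n (leqnn n).
  have inS i : i \in S.
    suff -> : S = setT by rewrite inE.
    by apply/eqP; rewrite eqEcard subsetT cardsT card_ord S_full /=.
  exists M, pi; split=> // [i j|i j]; first exact: pi_inj.
  exact: TM_S.
elim: q => [_|q IHq q_lt].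
  exists set0, 1%:M, id; rewrite cards0 unitmx1; split=> //.
  - by move=> i j; rewrite mxE; case: (i =P j) => [->|]; rewrite ?eqxx.
  - by split=> [k l|j k|k l]; rewrite inE.
have [S [M [pi [S_q M_unit M_compat pi_inj [S_low TM_S TM_notS]]]]] := IHq (ltnW q_lt).
have [k0 k0_notS] : exists k0, k0 \notin S.
  apply/existsP; rewrite -[X in is_true X]negbK negb_exists; apply/negP.
  move=> /forallP allS; have : #|S| = n.
    by rewrite (_ : S = setT) ?cardsT ?card_ord //; apply/setP=> i;
      rewrite inE; apply: negbNE; apply: allS.
  by rewrite S_q => q_n; move: q_lt; rewrite q_n ltnn.
pose k := [arg min_(k < k0 | k \notin S) w k].
have [k_notS k_min] : k \notin S /\ forall l, l \notin S -> (w k <= w l)%N.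
  by rewrite /k; case: arg_minnP.
pose X := T *m M.
have [p0 Xp0] : exists p0, X p0 k != 0.
  apply/existsP; rewrite -[X in is_true X]negbK negb_exists; apply/negP.
  move=> /forallP Xk0; have X_unit : X \in unitmx by rewrite unitmx_mul T_unit.
  have : col k X = 0.
    by apply/colP => i; rewrite [LHS]mxE [RHS]mxE; apply/eqP/negbNE/Xk0.
  rewrite colE => /(congr1 (mulmx (invmx X))); rewrite mulKmx // mulmx0.
  by move/matrixP/(_ k 0)/eqP; rewrite !mxE !eqxx oner_eq0.
pose p := [arg max_(p > p0 | X p k != 0) w' p].
have [Xpk p_max] : X p k != 0 /\ forall i, X i k != 0 -> (w' i <= w' p)%N.
  by rewrite /p; case: arg_maxnP.
(* Clears row p in the unprocessed columns. Column k is only subtracted from columns at least as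
   heavy, which preserves [wcompat]. *)
pose r : 'rV[K]_n := \row_l if (l \in S) || (l == k) then 0 else X p l / X p k.
have r0 l : l \in k |: S -> r 0 l = 0.
  by rewrite !inE mxE orbC => ->.
have E_unit := column_step (r0 k (setU11 k S)).
set E := 1%:M - _ in E_unit.
have XE i l : (T *m (M *m E)) i l = X i l - X i k * r 0 l.
  by rewrite mulmxA mul_column_step.
exists (k |: S), (M *m E), (fun i => if i == k then p else pi i); split.
- by rewrite cardsU1 k_notS S_q.
- by rewrite unitmx_mul M_unit.
- move=> i l; rewrite mul_column_step.
  have [Mil0|/M_compat //] := eqVneq (M i l) 0.
  have [->|Mik] := eqVneq (M i k) 0; first by rewrite Mil0 mul0r subr0 eqxx.
  have [l_S|l_notS] := boolP (l \in k |: S).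
    by rewrite Mil0 r0 // mulr0 subr0 eqxx.
  move=> _; apply: leq_trans (M_compat _ _ Mik) (k_min _ _).
  by move: l_notS; rewrite !inE negb_or => /andP[].
- have pi_p i : i \in S -> pi i != p.
    by move=> i_S; apply: contraNneq Xpk => <-; rewrite TM_notS.
  move=> i l; rewrite !inE.
  case: (eqVneq i k) => [->|_] /=; case: (eqVneq l k) => [->|_] //= i_S l_S.
  - by move=> p_pi; have := pi_p l l_S; rewrite p_pi eqxx.
  - by move=> pi_p'; have := pi_p i i_S; rewrite pi_p' eqxx.
  - exact: pi_inj.
split=> [i l|j i i_kS|i l].
- rewrite !inE negb_or => i_kS /andP[l_k l_S].
  by case/predU1P: i_kS => [->|i_S]; [apply: k_min | apply: S_low].
- rewrite XE r0 // mulr0 subr0; move: i_kS; rewrite !inE.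
  by case: eqP => [-> _|_ /= i_S]; [apply: p_max | apply: TM_S].
- move=> i_kS; rewrite !inE negb_or => /andP[l_k l_S].
  rewrite XE [r 0 l]mxE (negPf l_k) (negPf l_S) /=.
  move: i_kS; rewrite !inE; case: eqP => [_ _|_ /= i_S].
    by rewrite mulrC divfK // subrr.
  by rewrite /X !TM_notS // mul0r subr0.
Qed.

(** * Subspaces spanned by the heavy forms *)

Lemma rank_indicator_diag_le (K : fieldType) (n : nat) (b : pred 'I_n) :
  (\rank (diag_mx (\row_i (b i)%:R : 'rV[K]_n)) <= #|b|)%N.
Proof.
rewrite diag_mx_sum_delta -sum1_card [X in (_ <= X)%N]big_mkcond /=.
elim/big_rec2: _ => [|i m A _ rkA]; first by rewrite mxrank0.
rewrite (leq_trans (mxrank_add _ _)) // leq_add // mxE -[_ \in b]/(b i).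
by case: (b i); rewrite ?scale1r ?mxrank_delta // scale0r mxrank0.
Qed.

(** The matrices of b and of its complement sum to the identity, so both upper bounds are
    attained. *)
Lemma rank_indicator_diag (K : fieldType) (n : nat) (b : pred 'I_n) :
  \rank (diag_mx (\row_i (b i)%:R : 'rV[K]_n)) = #|b|.
Proof.
apply/eqP; rewrite eqn_leq rank_indicator_diag_le /=.
have := rank_indicator_diag_le K (predC b).
set D := diag_mx (\row_i (b i)%:R); set D' := diag_mx _ => rkD'.
have DD' : D + D' = 1%:M.
  apply/matrixP => i j; rewrite !mxE -mulrnDl; congr (_ *+ _).
  by rewrite /=; case: (b i); rewrite ?addr0 ?add0r.
rewrite -(leq_add2r #|predC b|) cardC card_ord -{1}(mxrank1 K n) -DD'.
exact: leq_trans (mxrank_add _ _) (leq_add (leqnn _) rkD').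
Qed.

Section Levels.
Variables (K : fieldType) (n : nat).
Implicit Types (A C M : 'M[K]_n) (w : 'I_n -> nat) (t : nat).

(** In coordinates y with x = A y, the form y_i is row i of [invmx A]; the row space is the span of
    the y_i of weight at least t. *)
Definition level t w A : 'M[K]_n :=
  diag_mx (\row_i (t <= w i)%:R) *m invmx A.

Lemma rank_level t w A : A \in unitmx ->
  \rank (level t w A) = #|[pred i | (t <= w i)%N]|.
Proof.
move=> A_unit; rewrite mxrankMfree ?rank_indicator_diag //.
by rewrite row_free_unit unitmx_inv.
Qed.

Lemma eq_level t w w' A : (forall i, (t <= w i)%N = (t <= w' i)%N) ->
  level t w A = level t w' A.
Proof.
by move=> ww'; congr (diag_mx _ *m _); apply/rowP => i; rewrite !mxE ww'.
Qed.

(** Compatibility writes heavy old forms in heavy new ones; [pi] permutes the weights, so the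
    dimensions agree. *)
Lemma level_change t w (pi : 'I_n -> 'I_n) A M : A \in unitmx -> M \in unitmx ->
  injective pi -> wcompat w (w \o pi) M ->
  (level t w A == level t (w \o pi) (A *m M))%MS.
Proof.
move=> A_unit M_unit pi_inj M_compat.
have AM_unit : A *m M \in unitmx by rewrite unitmx_mul A_unit.
have sub : (level t w A <= level t (w \o pi) (A *m M))%MS.
  have DM : diag_mx (\row_i (t <= w i)%:R) *m M =
      diag_mx (\row_i (t <= w i)%:R) *m M *m
      diag_mx (\row_j (t <= (w \o pi) j)%:R).
    apply/matrixP => i j; rewrite mul_mx_diag mul_diag_mx !mxE.
    have [->|/M_compat wi_wj] := eqVneq (M i j) 0; first by rewrite !mulr0 mul0r.
    have [t_wi|_] := leqP t (w i); last by rewrite !mul0r.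
    by rewrite (leq_trans t_wi wi_wj) mulr1.
  have -> : level t w A = diag_mx (\row_i (t <= w i)%:R) *m M *m invmx (A *m M).
    by rewrite -mulmxA -{1}[M](mulKmx A_unit) -(mulmxA _ (A *m M)) mulmxV // mulmx1.
  by rewrite DM -mulmxA submxMl.
rewrite -(mxrank_leqif_eq sub) !rank_level //.
by rewrite -!sum1_card (reindex_inj pi_inj).
Qed.
End Levels.

(** * Weights of minimal cost *)

(** The square gives strict convexity; the linear term, for large B, lets a cost bound control the
    total weight. *)
Definition cost (B x : nat) : nat := x ^ 2 + B * x.

(** The parallelogram identity, with the error of rounding the mean up. Subtraction truncates, so
    the two squares add up to the squared distance. *)
Lemma cost_mean (B x y : nat) :
  (4 * cost B (uphalf (x + y)) + ((x - y) ^ 2 + (y - x) ^ 2) <=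
     2 * cost B x + 2 * cost B y + 2 * (x + y) + 1 + 2 * B)%N.
Proof.
wlog le_yx : x y / (y <= x)%N.
  move=> H; have [/H //|/ltnW/H] := leqP y x.
  by rewrite [(y + x)%N]addnC; lia.
have -> : (y - x = 0)%N by apply/eqP; rewrite subn_eq0.
have [z Dx] : exists z, x = (y + z)%N by exists (x - y)%N; rewrite subnKC.
rewrite {}Dx in le_yx *; rewrite addKn.
have : (2 * uphalf (y + z + y) <= y + z + y + 1)%N by lia.
move: (uphalf _) => u u_le.
have := leq_mul u_le u_le; have := leq_mul (leqnn B) u_le.
by rewrite /cost -!mulnn; clear; lia.
Qed.

Lemma sum_cost_mean (n B : nat) (c q a b x y : 'I_n -> nat) :
  (forall i, 4 * c i + q i <= 2 * a i + 2 * b i + 2 * (x i + y i) + 1 + 2 * B)%N ->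
  (4 * (\sum_i c i) + \sum_i q i <= 2 * (\sum_i a i) + 2 * (\sum_i b i) +
     2 * (\sum_i x i + \sum_i y i) + n + 2 * n * B)%N.
Proof.
elim: n c q a b x y => [|n IHn] c q a b x y le_i; first by rewrite !big_ord0.
have := IHn _ _ _ _ _ _ (fun i => le_i (lift ord0 i)); have := le_i ord0.
rewrite !big_ord_recl.
move: (\sum_(i < n) c _)%N (\sum_(i < n) q _)%N (\sum_(i < n) a _)%N.
move: (\sum_(i < n) b _)%N (\sum_(i < n) x _)%N (\sum_(i < n) y _)%N.
lia.
Qed.

(** Permuting weights keeps their total cost, so on summing [cost_mean] the costs cancel and the
    rounding errors bound each squared distance. *)
Lemma cost_mean_close (n B : nat) (w : 'I_n -> nat) (pi : 'I_n -> 'I_n) :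
  injective pi ->
  (\sum_i cost B (w i) <= \sum_i cost B (uphalf (w i + w (pi i))))%N ->
  forall i, ((w i - w (pi i)) ^ 2 + (w (pi i) - w i) ^ 2 <=
    4 * (\sum_i w i) + n + 2 * n * B)%N.
Proof.
move=> pi_inj le_cost i.
have reind F : (\sum_i F (w (pi i)) = \sum_i F (w i))%N.
  by rewrite [RHS](reindex_inj pi_inj).
have := sum_cost_mean (fun l => cost_mean B (w l) (w (pi l))).
rewrite (reind (cost B)) (reind id) [X in (_ + X <= _)%N](bigD1 i) //=.
move: le_cost; move: (\sum_i cost _ _)%N (\sum_i cost _ _)%N (\sum_i w i)%N.
by move: (\sum_(j | _) _)%N ((_ - _) ^ 2 + _)%N; clear; lia.
Qed.

(** Pigeonhole: n weights cannot meet all of n + 1 disjoint windows of length [delta] below T; t is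
    the upper end of a missed one. *)
Lemma weight_gap (n T delta : nat) (w : 'I_n -> nat) : (0 < delta)%N ->
  (n.+1 * delta <= T)%N ->
  exists2 t, (T <= t + n * delta)%N && (t <= T)%N &
    forall i, ~~ (t <= w i + delta)%N || (t <= w i)%N.
Proof.
move=> delta_gt0 T_ge; apply: contrapT => no_gap.
have /choice[h hP] : forall q : 'I_n.+1, exists i,
    (T - q * delta <= w i + delta)%N && (w i < T - q * delta)%N.
  move=> q; apply: contrapT => gap; apply: no_gap.
  exists (T - q * delta)%N; last first.
    move=> i; apply/negPn/negP; rewrite negb_or negbK -ltnNge => h.
    by apply: gap; exists i.
  have : (q <= n)%N by rewrite -ltnS.
  by move: (nat_of_ord q) => {q gap} q le_q; nia.
have h_inj : injective h.
  move=> p q hpq; have := hP p; have := hP q; rewrite hpq.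
  move: (ltn_ord p) (ltn_ord q) => p_lt q_lt /andP[a b] /andP[c e].
  by apply: val_inj => /=; nia.
by have := leq_card h h_inj; rewrite !card_ord ltnn.
Qed.

(** With B = 2 r d^2 T the hypothesis gives S <= r d T + T / 2. The rounding error is then at most T
    Q = K Q delta < delta^2, and T > 2 n delta (d r + 1) makes d r + 1 weights of size t exceed
    S. *)
Lemma scale_choice (n r d : nat) : (0 < r)%N -> (0 < d)%N ->
  exists delta T B : nat,
  [/\ (0 < delta)%N, (n.+1 * delta <= T)%N &
    forall S, (B * S <= r * cost B (d * T))%N ->
      (4 * S + n + 2 * n * B < delta ^ 2)%N /\
      (forall t N, T <= t + n * delta -> t * N <= S -> N <= d * r)%N].
Proof.
move=> r_gt0 d_gt0.
pose K := (2 * n * (d * r + 1) + n.+1)%N.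
pose Q := (2 + 4 * r * d + n + 4 * n * r * d ^ 2)%N.
pose delta := (K * Q + 1)%N; pose T := (K * delta)%N.
have delta_gt0 : (0 < delta)%N by rewrite /delta addn1.
have K_gt0 : (0 < K)%N by rewrite /K addnS.
have T_gt0 : (0 < T)%N by rewrite muln_gt0 K_gt0.
exists delta, T, (2 * r * d ^ 2 * T)%N; split=> //.
  by rewrite leq_mul2r /K leq_addl orbT.
move=> S S_le.
have {S_le} S_le : (2 * S <= T + 2 * r * d * T)%N.
  rewrite -(@leq_pmul2l (2 * r * d ^ 2 * T)); last first.
    by rewrite !muln_gt0 r_gt0 d_gt0 K_gt0 delta_gt0.
  by move: (T) S_le => T'; rewrite /cost -!mulnn; clear; lia.
split.
  have -> : (delta ^ 2 = (K * Q + 1) * delta)%N by [].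
  have : (4 * S + n + 2 * n * (2 * r * d ^ 2 * T) <= T * Q)%N.
    have := leq_pmulr n T_gt0; rewrite /Q.
    by move: (T) S_le => T'; rewrite -!mulnn; clear; lia.
  have -> : (T * Q = K * Q * delta)%N by rewrite /T -!mulnA [(delta * _)%N]mulnC.
  by move: (K * Q)%N delta_gt0 (4 * S + n + _)%N => KQ; clear; lia.
move=> t N t_ge tN_le; rewrite leqNgt; apply/negP => N_gt.
have tdr : (t * (d * r + 1) <= S)%N.
  by apply: leq_trans tN_le; rewrite leq_mul2l addn1 N_gt orbT.
have T_lt : (2 * n * delta * (d * r + 1) < T)%N.
  rewrite /T /K; have := leq0n (n * delta).
  by move: (delta) delta_gt0 => e; clear; lia.
have := leq_mul t_ge (leqnn (d * r + 1)).
by move: (T) (delta) tdr T_lt S_le => T' e; clear; lia.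
Qed.

(** In the coordinates of A, a substitution killing the level kills every variable of weight at
    least t, so [lsubst_eq0] applies. *)
Lemma vanishes_on_level (K : fieldType) (n d t D : nat) (w : 'I_n -> nat)
    (A : 'M[K]_n) (f : {mpoly K[n]}) : (0 < d)%N -> (t * d <= D)%N ->
  f \is d.-homog -> A \in unitmx -> wge w D (lsubst A f) ->
  vanishes_on (level t w A) f.
Proof.
move=> d_gt0 td_le f_homog A_unit A_ge; apply/vanishes_onP => P LP0.
rewrite -[P](mulKVmx A_unit) -lsubst_comp.
apply: (lsubst_eq0 d_gt0 td_le _ A_ge); first exact: lsubst_dhomog.
move=> i t_wi; have /(congr1 (row i)) := LP0.
rewrite /level -mulmxA row_mul row_diag_mx mxE t_wi scale1r -rowE row0.
exact.
Qed.

(** Complete a basis of the row space of L to a coordinate system; its first [\rank L] forms get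
    weight D, the others 0. *)
Lemma vanishes_on_coordinates (K : fieldType) (m n D : nat) (L : 'M[K]_(m, n))
    (f : {mpoly K[n]}) : vanishes_on L f ->
  exists2 A : 'M[K]_n, A \in unitmx &
    wge (fun i => if (i < \rank L)%N then D else 0%N) D (lsubst A f).
Proof.
move=> /vanishes_onP f0; exists (invmx (row_ebase L)).
  by rewrite unitmx_inv row_ebase_unit.
apply: wge_copid; rewrite lsubst_comp; apply: f0.
rewrite -{1}(mulmx_ebase L) !mulmxA mulmxK ?row_ebase_unit //.
by rewrite -mulmxA mul_pid_mx_copid ?rank_leq_col // mulmx0.
Qed.

(* The weights minimize a strictly convex cost over all coordinate systems, so
   any two minimizers nearly agree on a common adapted basis: their mean, rounded
   up, is still admissible.  The threshold t sits in a gap between weights, hence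
   cuts out the same subspace for all minimizers. *)
Lemma stable_level (K : fieldType) (n d r m : nat) (L : 'M[K]_(m, n))
    (f : {mpoly K[n]}) : (0 < r)%N -> (0 < d)%N -> (\rank L <= r)%N ->
  vanishes_on L f ->
  exists (A : 'M[K]_n) (w : 'I_n -> nat) (t D : nat),
    [/\ A \in unitmx, wge w D (lsubst A f), (t * d <= D)%N,
        (\rank (level t w A) <= d * r)%N
      & forall A', A' \in unitmx -> wge w D (lsubst A' f) ->
          (level t w A' == level t w A)%MS].
Proof.
move=> r_gt0 d_gt0 rkL f0.
have [delta [T [B [delta_gt0 T_ge scaleP]]]] := scale_choice n r_gt0 d_gt0.
pose D := (d * T)%N.
have [A0 A0_unit A0_ge] := vanishes_on_coordinates D f0.
pose adm A w := A \in unitmx /\ wge w D (lsubst A f).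
pose P c := exists (A : 'M[K]_n) (w : 'I_n -> nat),
  adm A w /\ (\sum_i cost B (w i))%N = c.
set w0 := (fun i : 'I_n => _) in A0_ge.
have P0 : P (\sum_i cost B (w0 i))%N by exists A0, w0.
have [[A [w [[A_unit A_ge] wc]]] min_c] := natinf_spec (ex_intro P _ P0).
have c_le : (natinf P <= r * cost B D)%N.
  apply: leq_trans (min_c _ P0) _.
  rewrite /w0 (eq_bigr (fun i : 'I_n => if (i < \rank L)%N then cost B D else 0%N)).
    rewrite -big_mkcond /= -(big_ord_widen _ (fun=> cost B D) (rank_leq_col L)).
    by rewrite sum_nat_const card_ord leq_mul2r rkL orbT.
  by move=> i _; case: ifP => // _; rewrite /cost muln0.
have [small_gap rk_le] : (4 * (\sum_i w i) + n + 2 * n * B < delta ^ 2)%N /\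
    forall t N, (T <= t + n * delta -> t * N <= \sum_i w i -> N <= d * r)%N.
  apply: scaleP; apply: leq_trans c_le; rewrite -wc big_distrr /=.
  by apply: leq_sum => i _; rewrite leq_addl.
have [t /andP[t_ge t_le] gap] := weight_gap w delta_gt0 T_ge.
exists A, w, t, D; split=> //.
- by rewrite /D mulnC leq_mul2l t_le orbT.
- rewrite rank_level //; apply: rk_le t_ge _.
  rewrite -sum1_card big_distrr /= big_mkcond /=; apply: leq_sum => i _.
  by rewrite inE; case: ifP => //; rewrite muln1.
move=> A' A'_unit A'_ge.
have T_unit : invmx A *m A' \in unitmx by rewrite unitmx_mul unitmx_inv A_unit.
have [M [pi [M_unit pi_inj M_compat TM_compat]]] := common_basis w w T_unit.
pose C := A' *m M; pose M' := invmx A *m A' *m M.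
have AM' : A *m M' = C by rewrite /M' -mulmxA mulKVmx.
have M'_unit : M' \in unitmx by rewrite unitmx_mul T_unit.
have C_ge : wge w D (lsubst C f).
  by rewrite -lsubst_comp; apply: wge_lsubst A'_ge.
have C_ge_pi : wge (w \o pi) D (lsubst C f).
  by rewrite -AM' -lsubst_comp; apply: wge_lsubst A_ge.
(* The rounded mean of w and [w \o pi] is admissible for C, so it costs no less than the minimiser
   w. *)
have close i : ((w i - w (pi i)) ^ 2 + (w (pi i) - w i) ^ 2 < delta ^ 2)%N.
  apply: leq_ltn_trans small_gap; apply: cost_mean_close => //.
  rewrite wc; apply: min_c; exists C, (fun i => uphalf (w i + w (pi i))).
  split; last reflexivity.
  split; first by rewrite unitmx_mul A'_unit M_unit.
  by apply: wge_mean C_ge C_ge_pi _ => j /=; lia.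
(* These weights differ by less than [delta] and none lies in [t - delta, t), so both are on the
   same side of t. *)
have same_level i : (t <= w i)%N = (t <= (w \o pi) i)%N.
  have := close i; have := gap i; have := gap (pi i) => /=.
  move: (w i) (w (pi i)) => x y; rewrite -!mulnn; clear -delta_gt0; nia.
have /eqmxP A'C := level_change t A'_unit M_unit (@inj_id _) M_compat.
have /eqmxP AC := level_change t A_unit M'_unit pi_inj TM_compat.
apply/eqmxP/(eqmx_trans A'C)/eqmx_sym/(eqmx_trans AC).
by rewrite AM' -/C -(eq_level _ same_level).
Qed.

(** * Descent of slice rank *)

Lemma map_level (E F : fieldType) (j : {rmorphism E -> F}) (n t : nat)
    (w : 'I_n -> nat) (A : 'M[E]_n) :
  map_mx j (level t w A) = level t w (map_mx j A).
Proof.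
rewrite map_mxM map_invmx map_diag_mx; congr (diag_mx _ *m _).
by apply/rowP => i; rewrite !mxE rmorph_nat.
Qed.

Section Descent.
Variables (k : fieldType) (F : closedFieldType) (iota : {rmorphism k -> F}).
Hypothesis k_perfect : perfect_field k.
Hypothesis F_alg : forall x : F, algebraicOver iota x.

Lemma slice_rank_descent (n d : nat) (f : {mpoly k[n]}) : (0 < d)%N ->
  f \is d.-homog -> (slice_rank f <= d * slice_rank (map_mpoly iota f))%N.
Proof.
move=> d_gt0 f_homog; set fF := map_mpoly iota f.
have fF_homog : fF \is d.-homog by apply: map_mpoly_dhomog.
have [L [rkL L0]] := slice_rank_ex d_gt0 fF_homog.
have [r0|r_gt0] := posnP (slice_rank fF).
  have L_eq0 : L = 0 by apply/eqP; rewrite -mxrank_eq0 -leqn0 -r0.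
  have /vanishes_onP fF0 := L0.
  have f0 : f = 0.
    apply/eqP; rewrite -(map_mpoly_eq0 iota) -/fF -[fF]lsubst1.
    by apply/eqP; apply: fF0; rewrite L_eq0 mul0mx.
  rewrite r0 muln0 -(mxrank0 k n n); apply: (slice_rank_le d_gt0 f_homog).
  by rewrite f0; apply: linear0.
have [A [w [t [D [A_unit A_ge td_le rk_le stable]]]]] :=
  stable_level r_gt0 d_gt0 rkL L0.
have [|R RE] := descent_submx (W := level t w A) (s := mx_entries A) k_perfect F_alg.
  (* As f has coefficients in k, conjugating A gives another coordinate system admissible for the
     same weights, and [stable] identifies the levels. *)
  move=> E i j sigma W0 ji sigmai im W0E.
  have [A0 A0E] := image_mx_entries im.
  have -> : W0 = level t w A0.
    by apply: (map_mx_inj (f := j)); rewrite map_level A0E.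
  rewrite map_level; apply: stable.
    by rewrite map_unitmx -(map_unitmx j) A0E.
  rewrite /fF -(map_mpoly_id_comp f sigmai) -map_lsubst; apply/wge_map.
  by apply/(wge_map j); rewrite map_lsubst A0E (map_mpoly_id_comp f ji).
apply: leq_trans rk_le; apply: leq_trans (rank_leq_row R).
apply: (slice_rank_le d_gt0 f_homog); apply/(map_vanishes_on iota).
apply: (@vanishes_onS _ _ _ _ (level t w A)); first by case/andP: RE.
exact: vanishes_on_level d_gt0 td_le fF_homog A_unit A_ge.
Qed.

Lemma collective_slice_rank_descent (n d s : nat) (f : 'I_s -> {mpoly k[n]}) :
  (0 < d)%N -> (0 < s)%N -> (forall i, f i \is d.-homog) ->
  (collective_slice_rank f <=
     d * s * collective_slice_rank (fun i => map_mpoly iota (f i)))%N.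
Proof.
move=> d_gt0 s_gt0 f_homog.
have [[c c_neq0]] := collective_slice_rank_spec
  (fun i => map_mpoly iota (f i)) s_gt0.
set r := collective_slice_rank _ => rE _.
pose comb (K : fieldType) (j : {rmorphism k -> K}) (v : 'rV[K]_s) :=
  \sum_l v 0 l *: map_mpoly j (f l).
have comb_homog (K : fieldType) (j : {rmorphism k -> K}) v : comb K j v \is d.-homog.
  by apply: rpred_sum => l _; rewrite rpredZ ?map_mpoly_dhomog.
pose good m (C : 'M[F]_(m, s)) :=
  forall i, (slice_rank (comb F iota (row i C)) <= r)%N.
(* Minimising s minus the rank selects a good C of largest rank; its rows span all good vectors. *)
pose P q := exists m (C : 'M[F]_(m, s)), good m C /\ (s - \rank C)%N = q.
pose c_row : 'rV[F]_s := \row_l c l.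
have c_row_neq0 : c_row != 0.
  apply: contraNneq c_neq0 => c0; apply/eqP/ffunP => l.
  by move/rowP/(_ l): c0; rewrite !mxE ffunE.
have c_good : good 1%N c_row.
  move=> i; rewrite rE /comb; apply: eq_leq; congr slice_rank.
  by apply: eq_bigr => l _; rewrite !mxE.
have [[m [C [C_good CE]]] C_max] :=
  natinf_spec (ex_intro P _ (ex_intro _ _ (ex_intro _ _ (conj c_good erefl)))).
have rk_max m' (C' : 'M[F]_(m', s)) : good m' C' -> (\rank C' <= \rank C)%N.
  move=> C'_good; have := C_max _ (ex_intro _ _ (ex_intro _ _ (conj C'_good erefl))).
  by rewrite -CE; have := rank_leq_col C; have := rank_leq_col C'; lia.
have rkC_gt0 : (0 < \rank C)%N.
  by apply: leq_trans (rk_max _ _ c_good); rewrite lt0n mxrank_eq0.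
have /choice[L LP] : forall i, exists L : 'M[F]_n,
    (\rank L <= r)%N /\ vanishes_on L (comb F iota (row i C)).
  move=> i; have [L [rkL L0]] := slice_rank_ex d_gt0 (comb_homog F iota (row i C)).
  by exists L; split=> //; apply: leq_trans rkL (C_good i).
(* The entries of the [L i] are put into the image of [j] too, so that the subspaces witnessing
   slice rank at most r can be conjugated. *)
have [|R RE] := descent_submx (W := C)
    (s := flatten [seq mx_entries (L i) | i : 'I_m]) k_perfect F_alg.
  move=> E i j sigma C0 ji sigmai im C0E.
  have map_comb (h : {rmorphism E -> F}) v : (forall x, h (i x) = iota x) ->
      map_mpoly h (comb E i v) = comb F iota (map_mx h v).
    move=> hi; rewrite raddf_sum; apply: eq_bigr => l _ /=.
    by rewrite map_mpolyZ (map_mpoly_id_comp _ hi) mxE.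
  have C'_good : good m (map_mx sigma C0).
    move=> a; have [|L0 L0E] := @image_mx_entries _ _ j _ _ (L a).
      move=> z z_L; apply: im; apply/flatten_mapP; exists a => //.
      exact: mem_enum.
    have [rkL La0] := LP a.
    rewrite -map_row -map_comb //.
    apply: leq_trans (slice_rank_le (L := map_mx sigma L0) d_gt0 _ _) _.
    - by apply: map_mpoly_dhomog; apply: comb_homog.
    - apply/map_vanishes_on; apply/(map_vanishes_on j).
      by rewrite (map_comb _ _ ji) map_row C0E L0E.
    - by rewrite mxrank_map -(mxrank_map j) L0E.
  (* Stacking the conjugate under C gives a good matrix, whose rank cannot exceed that of C. *)
  have sub : (map_mx sigma C0 <= C)%MS.
    have col_good : good _ (col_mx C (map_mx sigma C0)).
      move=> a; rewrite -[a]splitK; case: (split a) => b /=.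
        by rewrite rowKu.
      by rewrite rowKd.
    have C_sub : (C <= col_mx C (map_mx sigma C0))%MS.
      by rewrite -addsmxE addsmxSl.
    have /eqmxP-> : (C == col_mx C (map_mx sigma C0))%MS.
      rewrite -(mxrank_leqif_eq C_sub) eqn_leq mxrankS //=.
      exact: rk_max.
    by rewrite -addsmxE addsmxSr.
  rewrite -(mxrank_leqif_eq sub) mxrank_map -(mxrank_map j) C0E.
  exact: eqxx.
have [a Ra_neq0] : exists a, row a R != 0.
  apply/existsP; rewrite -[X in is_true X]negbK negb_exists; apply/negP.
  move=> /forallP R0; move: rkC_gt0; rewrite -(eqmx_rank RE).
  rewrite mxrank_map (_ : R = 0) ?mxrank0 //.
  by apply/row_matrixP => a; rewrite row0; apply/eqP/negbNE/R0.
pose c' : {ffun 'I_s -> k} := [ffun l => R a l].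
have c'_neq0 : c' != 0.
  apply: contraNneq Ra_neq0 => c'0; apply/eqP/rowP => l.
  by move/ffunP/(_ l): c'0; rewrite !ffunE !mxE.
have [_ /(_ c' c'_neq0)] := collective_slice_rank_spec f s_gt0.
move=> /leq_trans; apply; rewrite -mulnA.
apply: leq_trans (slice_rank_descent d_gt0 _) _.
  by apply: rpred_sum => l _; rewrite rpredZ ?f_homog.
rewrite leq_mul2l; apply/orP; right.
(* Independent rows of C suffice to express the descended vector; there are at most s of them,
   whence the factor s. *)
have /submxP[u uE] : (map_mx iota (row a R) <= rowsub (maxrankfun C) C)%MS.
  by rewrite eq_maxrowsub map_row (submx_trans (row_sub _ _)) //; case/andP: RE.
have -> : map_mpoly iota (\sum_l c' l *: f l) =
    \sum_b u 0 b *: comb F iota (row (maxrankfun C b) C).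
  have -> : map_mpoly iota (\sum_l c' l *: f l) = comb F iota (map_mx iota (row a R)).
    rewrite raddf_sum; apply: eq_bigr => l _ /=.
    by rewrite map_mpolyZ ffunE !mxE.
  under [RHS]eq_bigr do rewrite scaler_sumr.
  rewrite uE exchange_big; apply: eq_bigr => l _ /=.
  rewrite mxE scaler_suml; apply: eq_bigr => b _.
  by rewrite scalerA !mxE.
apply: leq_trans (slice_rank_sum (s := index_enum _) (u 0)
  (F := fun b => comb F iota (row (maxrankfun C b) C)) (r := r) d_gt0 _ _) _.
- by move=> b _; apply: comb_homog.
- by move=> b _; apply: C_good.
rewrite leq_mul2r; apply/orP; right.
by rewrite [index_enum _]unlock -enumT size_enum_ord rank_leq_col.
Qed.
End Descent.

Theorem theoremA (k : fieldType) (kbar : closedFieldType)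
    (iota : {rmorphism k -> kbar}) (n d : nat)
    (k_perfect : perfect_field k)
    (kbar_algebraic : forall x : kbar, algebraicOver iota x)
    (d_ge2 : (2 <= d)%N) :
  (forall f : {mpoly k[n]}, f \is d.-homog ->
     (slice_rank f <= d * slice_rank (map_mpoly iota f))%N) /\
  (forall (s : nat) (f : 'I_s -> {mpoly k[n]}), (0 < s)%N ->
     (forall i, f i \is d.-homog) ->
     (collective_slice_rank f <=
        d * s * collective_slice_rank (fun i => map_mpoly iota (f i)))%N).
Proof.
have d_gt0 : (0 < d)%N := ltnW d_ge2.
split=> [f f_homog|s f s_gt0 f_homog].
  exact: slice_rank_descent.
exact: collective_slice_rank_descent.
Qed.
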